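(* Let $p$ be an odd prime, $n\ge 1$, and let $f(x)=\sum_{i=1}^k a_i x^{p^{\alpha_i}+1}\in\mathbb F_{p^n}[x]$ with $k\ge 1$, integers $0\le\alpha_1<\cdots<\alpha_k$, and $a_k\ne 0$. Assume that $\nu_2(\alpha_1)=\cdots=\nu_2(\alpha_k)=\nu$ and that $\nu_2(n)>\nu$. Then $2^{\nu+1}\mid l_n(f)$ and $$t_n(f)=(-1)^{\left(\frac14(p-1)^2 2^\nu+1\right)\frac{n-l_n(f)}{2^{\nu+1}}}=\begin{cases}(-1)^{\left(\frac14(p-1)^2+1\right)\frac{n-l_n(f)}{2^{\nu+1}}}&\text{if }\nu=0,\\ (-1)^{\frac{n-l_n(f)}{2^{\nu+1}}}&\text{if }\nu>0.\end{cases}$$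
   Context: $\nu_2$ is the $2$-adic order, with $\nu_2(0)=\infty$. Every quadratic form $F$ on an $N$-dimensional $\mathbb F_p$-vector space ($p$ odd) is, after a linear change of coordinates, equal to $x_1^2+\cdots+x_{r-1}^2+d x_r^2$ with $r\ge 0$ and $d\in\mathbb F_p^*$. The integer $r$ is the rank of $F$, $N-r$ is its nullity, and $\eta(d)\in\{\pm1\}$ is its type, where $\eta$ is the quadratic character of $\mathbb F_p$; if $F=0$ its type is defined to be $1$. With $\mathrm{Tr}_n$ the absolute trace $\mathbb F_{p^n}\to\mathbb F_p$, the map $x\mapsto \mathrm{Tr}_n(f(x))$ is a quadratic form on the $n$-dimensional $\mathbb F_p$-space $\mathbb F_{p^n}$, and $l_n(f)$, $t_n(f)$ denote its nullity and type. *)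

(* Defs.v *)
From HB Require Import structures.
From mathcomp Require Import all_boot all_order all_algebra all_fingroup all_field.
From mathcomp Require Import boolp.

Set Implicit Arguments.
Unset Strict Implicit.
Unset Printing Implicit Defensive.

Import GRing.Theory.
Local Open Scope ring_scope.

(* [None] is the value infinity at 0, where [logn] returns 0. *)
Definition nu2 (m : nat) : option nat :=
  if (m == 0)%N then None else Some (logn 2 m).

Section QuadraticForms.

Variables (K : finFieldType) (V : vectType K).

Definition quad_char (d : K) : int :=
  if d == 0 then 0 else if [exists y : K, y ^+ 2 == d] then 1 else -1.

(* Coefficient of x_(i+1)^2 in x_1^2 + ... + x_(r-1)^2 + d x_r^2; the form is
   0 when r = 0. *)
Definition diag_coef (r : nat) (d : K) (i : nat) : K :=
  if (i.+1 < r)%N then 1 else if i.+1 == r then d else 0.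

(* The linear change of coordinates is given by the basis b. *)
Definition normal_form (Q : V -> K) (r : nat) (d : K) : Prop :=
  d != 0 /\
  exists2 b : (\dim {:V}).-tuple V, basis_of {:V} b &
    forall x : V, Q x = \sum_(i < \dim {:V}) diag_coef r d i * coord b i x ^+ 2.

(* In odd characteristic every quadratic form has a normal form, so the default
   value is never used; r and the class of d modulo squares (if r > 0) do not
   depend on the choice made by [pick]. *)
Definition normal_data (Q : V -> K) : 'I_(\dim {:V}).+1 * K :=
  odflt (ord0, 1)
    [pick rd : 'I_(\dim {:V}).+1 * K | `[< normal_form Q rd.1 rd.2 >]].

Definition qrank (Q : V -> K) : nat := (normal_data Q).1.

Definition nullity (Q : V -> K) : nat := (\dim {:V} - qrank Q)%N.

Definition qtype (Q : V -> K) : int :=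
  if qrank Q == 0%N then 1 else quad_char (normal_data Q).2.

End QuadraticForms.

Section Trace.

Variables (p : nat) (L : fieldExtType 'F_p).

(* The sum of the conjugates of x lies in the prime field; [pick] reads it as
   an element of 'F_p. *)
Definition abs_trace (x : L) : 'F_p :=
  odflt 0 [pick c : 'F_p | c%:A == \sum_(i < \dim {:L}) x ^+ (p ^ i)].

Lemma abs_traceE (x : L) : prime p ->
  (abs_trace x)%:A = \sum_(i < \dim {:L}) x ^+ (p ^ i).
Proof.
move=> p_pr; rewrite /abs_trace.
set s := \sum_(i < _) _.
suff /vlineP[c sE] : s \in (1%AS : {vspace L}).
  case: pickP => [d /eqP // | /(_ c)].
  by rewrite sE eqxx.
have cF : #|'F_p| = p by rewrite card_Fp.
have pL : p \in [pchar L] by rewrite (pchar_lalg L) pchar_Fp.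
rewrite (Fermat's_little_theorem 1%AS s) dimv1 expn1 cF.
have xE : x ^+ (p ^ \dim {:L}) = x.
  have /eqP := Fermat's_little_theorem {:L}%AS x.
  by rewrite cF memvf eq_sym eqb_id => /eqP.
rewrite -(pFrobenius_autE pL) /s raddf_sum /=.
case: (\dim {:L}) xE (adim_gt0 {:L}%AS) => // m xE _.
rewrite big_ord_recr big_ord_recl /= addrC pFrobenius_autE -exprM -expnSr xE.
rewrite expn0 expr1; apply/eqP; congr (_ + _); apply: eq_bigr => i _.
by rewrite pFrobenius_autE -exprM -expnSr.
Qed.

Definition trace_form (f : {poly L}) (x : L) : 'F_p := abs_trace f.[x].

Definition trace_nullity (f : {poly L}) : nat := nullity (trace_form f).

Definition trace_type (f : {poly L}) : int := qtype (trace_form f).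

End Trace.

(* Main.v *)
(* Put D = 2^nu, so that every alpha_i is an odd multiple of D and 2D | n. Let c
   in L have multiplicative order (p^D + 1)(p - 1). As c^(p^(2D)) = c, each
   monomial of f is multiplied by c^(p^D + 1), an element s of F_p^*, when x is
   replaced by c x; hence c is a similarity of the trace form Q. The group
   generated by c acts freely on the nonzero vectors and preserves both the
   radical, of cardinality p^l, and the set of zeros of Q. From
   p^D + 1 | p^l - 1 one gets 2D | l, because p has order 2D modulo p^D + 1. The
   number Z of zeros of a form of even rank r = 2D rho satisfies
   p Z = p^l (p^r + tau (p - 1) p^(r/2)) with tau = eta((-1)^(r/2) d), and
   (p^D + 1)(p - 1) | Z - 1 then forces tau = (-1)^rho. *)

Require Import Defs.
From HB Require Import structures.
From mathcomp Require Import all_boot all_order all_algebra all_fingroup all_field.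
From mathcomp Require Import boolp.
From mathcomp Require Import all_solvable zify ring.

Set Implicit Arguments.
Unset Strict Implicit.
Unset Printing Implicit Defensive.

Import GRing.Theory.
Local Open Scope ring_scope.

(** * The quadratic character and binary forms over a finite field *)

Section FiniteField.

Variable K : finFieldType.
Local Notation q := #|K|.

(** The [q - 1] nonzero elements are all roots of [X^(q-1) - 1], which forces one of them to be
    primitive; a suitable power of it has order [m]. *)
Lemma finField_prim_root_dvd m : (m %| q.-1)%N -> {c : K | m.-primitive_root c}.
Proof.
have q_gt1 := finNzRing_gt1 K.
have q1_gt0 : (0 < q.-1)%N by rewrite -subn1 subn_gt0.
suff [g gP] : {g : K | q.-1.-primitive_root g}.
  by move=> mq; exists (g ^+ (q.-1 %/ m)); apply: dvdn_prim_root.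
have := @has_prim_root K q.-1 (enum (predC1 (0 : K))) q1_gt0.
rewrite enum_uniq -cardE cardC1 => /(_ _ isT (leqnn _)) H.
suff /H /hasP/sig2W[g _ gP] : all q.-1.-unity_root (enum (predC1 (0 : K))).
  by exists g.
apply/allP=> x; rewrite mem_enum inE => x0; apply/unity_rootP.
apply: (mulfI x0); rewrite -exprS mulr1 prednK ?expf_card //.
exact: ltnW.
Qed.

Hypothesis oddK : odd q.
Local Notation h := (q.-1./2).

Lemma half_card_gt0 : (0 < h)%N.
Proof. by move: (finNzRing_gt1 K) oddK; set m := #|_|; lia. Qed.

Lemma double_half_card : (h * 2)%N = q.-1.
Proof. by move: (finNzRing_gt1 K) oddK; set m := #|_|; lia. Qed.

Lemma prim_root_half (g : K) : q.-1.-primitive_root g -> g ^+ h = -1.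
Proof.
move=> gP; have /eqP := prim_expr_order gP.
rewrite -{1}double_half_card exprM sqrf_eq1 => /orP[/eqP gh1|/eqP //].
have := @dvdn_leq q.-1 h half_card_gt0; rewrite (prim_order_dvd gP) gh1 eqxx.
by move/(_ isT); move: double_half_card half_card_gt0; set m := h; lia.
Qed.

Lemma odd_card_oppr1_neq1 : -1 != 1 :> K.
Proof.
have [g gP] := finField_prim_root_dvd (dvdnn _).
rewrite -(prim_root_half gP) -(prim_order_dvd gP).
apply/negP=> /(dvdn_leq half_card_gt0).
by move: double_half_card half_card_gt0; set m := h; lia.
Qed.

Lemma odd_card_two_neq0 : 2 != 0 :> K.
Proof.
by apply: contra odd_card_oppr1_neq1 => /eqP two0; rewrite eq_sym -subr_eq0 opprK -two0.
Qed.

(** Euler's criterion: a nonsquare is an odd power of a generator [g], and [g ^+ h = -1]. *)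
Lemma quad_charE (x : K) : (quad_char x)%:~R = x ^+ h.
Proof.
rewrite /quad_char; have [->|x0] := eqVneq x 0.
  by rewrite expr0n eqn0Ngt half_card_gt0.
have expq1 (y : K) : y != 0 -> y ^+ q.-1 = 1.
  move=> y0; apply: (mulfI y0); rewrite -exprS mulr1 prednK ?expf_card //.
  exact: ltnW (finNzRing_gt1 K).
case: existsP => [[y /eqP yx]|nsq].
  rewrite -yx -exprM mulnC double_half_card expq1 //.
  by apply: contraNneq x0 => y0; rewrite -yx y0 expr0n.
have [g gP] := finField_prim_root_dvd (dvdnn _).
have [[k k_lt] xE] := prim_rootP gP (expq1 x x0); rewrite /= in xE.
have kodd : odd k.
  apply/negPn/negP=> kev; apply: nsq; exists (g ^+ k./2).
  by rewrite -exprM xE; apply/eqP; congr (_ ^+ _); lia.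
by rewrite xE exprAC (prim_root_half gP) -signr_odd kodd expr1 rmorphN1.
Qed.

(** Euler's criterion gives the identity in [K]; it lifts to the integers because 0, 1 and -1 stay
    distinct in [K]. *)
Lemma quad_charM (x y : K) : quad_char (x * y) = quad_char x * quad_char y.
Proof.
have inj (u v : int) : u \in [:: 0; 1; -1] -> v \in [:: 0; 1; -1] ->
    u%:~R = v%:~R :> K -> u = v.
  have N := odd_card_oppr1_neq1; have N' : (-1 : K) != 0 by rewrite oppr_eq0 oner_neq0.
  rewrite !inE => /or3P[] /eqP-> /or3P[] /eqP-> //=; rewrite ?rmorph0 ?rmorph1 ?rmorphN1 => /eqP;
    rewrite ?(negPf N) ?(negPf N') ?oner_eq0 1?eq_sym ?(negPf N) ?(negPf N') ?oner_eq0 //.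
have val (z : K) : quad_char z \in [:: 0; 1; -1].
  by rewrite /quad_char; case: ifP => // _; case: ifP.
apply: inj => //; last by rewrite rmorphM /= !quad_charE exprMn.
by move: (val x) (val y); rewrite !inE => /or3P[] /eqP-> /or3P[] /eqP->.
Qed.

Lemma quad_charN1 : quad_char (-1 : K) = (-1) ^+ h.
Proof.
have := quad_charE (-1); rewrite -signr_odd -[in RHS]signr_odd /quad_char.
rewrite oppr_eq0 oner_eq0; have N := odd_card_oppr1_neq1.
case: ifP => _; case: (odd h) => //=; rewrite ?rmorph1 ?rmorphN1 ?expr1 ?expr0 => /eqP.
  by rewrite eq_sym (negPf N).
by rewrite (negPf N).
Qed.

Lemma quad_char_sqr (x : K) : x != 0 -> quad_char (x ^+ 2) = 1.
Proof.
move=> x0; rewrite /quad_char expf_eq0 (negPf x0).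
by case: existsP => // -[]; exists x.
Qed.

Lemma card_sqrt (u : K) : #|[pred x : K | x ^+ 2 == u]|%:Z = 1 + quad_char u.
Proof.
rewrite /quad_char; have [->|u0] := eqVneq u 0.
  rewrite (@eq_card1 _ (0 : K)) // => x; rewrite !inE expf_eq0 //.
case: existsP => [[y /eqP yu]|nsq]; last first.
  by rewrite (@eq_card0 _ _) // => x; rewrite !inE; apply/negP => xu; apply: nsq; exists x.
have y0 : y != 0 by apply: contraNneq u0 => y0; rewrite -yu y0 expr0n.
rewrite (@eq_card _ _ (pred2 y (- y))) ?card2; last first.
  by move=> x; rewrite !inE -yu eqf_sqr.
rewrite -addr_eq0 -mulr2n -mulr_natr mulf_eq0 negb_or y0 odd_card_two_neq0 //.
Qed.

(** Squaring is at most two-to-one, so [a x^2] and [c - b y^2] each take at least [q/2] values,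
    hence more than [q/2] as [q] is odd, and the two sets of values meet. *)
Lemma binary_form_surj (a b c : K) : a != 0 -> b != 0 ->
  exists x y, a * x ^+ 2 + b * y ^+ 2 = c.
Proof.
move=> a0 b0.
have sz (f : K -> K) : (forall x y, f x = f y -> x ^+ 2 = y ^+ 2) -> (q <= #|f @: K| * 2)%N.
  move=> fP.
  rewrite -[X in (X <= _)%N]sum1_card (partition_big f [in f @: K]) /=; last by move=> x _; apply: imset_f.
  apply: (@leq_trans (\sum_(t in f @: K) 2)%N); last by rewrite sum_nat_const.
  apply: leq_sum => _ /imsetP[y _ ->].
  rewrite sum1_card; apply: leq_trans (_ : #|pred2 y (- y)| <= 2)%N; last by rewrite card2; case: eqP.
  by apply: subset_leq_card; apply/subsetP=> x; rewrite !inE /= => /eqP/fP/eqP; rewrite eqf_sqr.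
pose f x := a * x ^+ 2; pose g y := c - b * y ^+ 2.
have sf : (q <= #|f @: K| * 2)%N by apply: sz => x y /(mulfI a0).
have sg : (q <= #|g @: K| * 2)%N by apply: sz => x y /addrI/oppr_inj/(mulfI b0).
have [|/pred0Pn[_ /andP[/imsetP[x _ ->] /imsetP[y _ E]]]] :=
    boolP [disjoint f @: K & g @: K]; last by exists x, y; rewrite [_ * _]E subrK.
rewrite -leq_card_setU => /eqP cU; exfalso.
have : (#|f @: K| + #|g @: K| <= q)%N by rewrite -cU max_card.
by move: sf sg oddK; move: #|f @: K| #|g @: K| #|K| => A B Q; lia.
Qed.

Definition binary_count (b t : K) : nat :=
  #|[pred z : K * K | z.1 ^+ 2 + b * z.2 ^+ 2 == t]|.

(* Brahmagupta's identity: multiplication by [u + v sqrt (- b)]. *)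
Lemma binary_count_mul (b s t : K) : b != 0 -> t != 0 ->
  (binary_count b s <= binary_count b (s * t)%R)%N.
Proof.
move=> b0 t0; have [u [v uv]] := binary_form_surj t (oner_neq0 K) b0.
rewrite mul1r in uv.
pose m (z : K * K) := (z.1 * u - b * z.2 * v, z.1 * v + z.2 * u).
(* Multiplying back by the conjugate [u - v sqrt (- b)] yields [t] times the differences of the
   coordinates. *)
have mI : injective m.
  move=> [x y] [x' y'] [E1 E2].
  have E3 : (x - x') * t = 0.
    apply: (@eq_trans _ _ (u * ((x * u - b * y * v) - (x' * u - b * y' * v))
      + b * v * ((x * v + y * u) - (x' * v + y' * u)))); first by rewrite -uv; ring.
    by rewrite E1 E2; ring.
  have E4 : (y - y') * t = 0.
    apply: (@eq_trans _ _ (u * ((x * v + y * u) - (x' * v + y' * u))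
      - v * ((x * u - b * y * v) - (x' * u - b * y' * v)))); first by rewrite -uv; ring.
    by rewrite E1 E2; ring.
  move/eqP: E3; move/eqP: E4; rewrite !mulf_eq0 (negPf t0) !orbF !subr_eq0.
  by move=> /eqP-> /eqP->.
rewrite /binary_count -(card_image mI); apply: subset_leq_card.
apply/subsetP=> _ /imageP[[x y] /= /eqP E ->]; rewrite !inE /= -E -uv.
by apply/eqP => /=; ring.
Qed.

Lemma binary_count_const (b t : K) : b != 0 -> t != 0 ->
  binary_count b t = binary_count b 1.
Proof.
move=> b0 t0; apply/eqP; rewrite eqn_leq.
have := binary_count_mul 1 b0 t0; rewrite mul1r => ->.
have := binary_count_mul t b0 (_ : t^-1 != 0).
by rewrite mulfV // invr_eq0 => ->.
Qed.

(** The zeros are counted through the square roots of [- b y^2] for each [y]; the remaining pairs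
    are shared equally by the [q - 1] nonzero values. *)
Lemma binary_countE (b t : K) : b != 0 ->
  (binary_count b t)%:Z = q%:Z - quad_char (- b) + q%:Z * quad_char (- b) * (t == 0)%:R.
Proof.
move=> b0; set e := quad_char (- b).
have H0 : (binary_count b 0)%:Z = q%:Z + (q%:Z - 1) * e.
  have -> : binary_count b 0 = (\sum_y #|[pred x : K | (x ^+ 2 == - b * y ^+ 2)%R]|)%N.
    rewrite /binary_count -sum1_card (partition_big snd xpredT) //=; apply: eq_bigr => y _.
    rewrite sum1_card -(card_image (_ : injective (fun x : K => (x, y)))); last by move=> x x' [].
    apply: eq_card => -[x y']; rewrite unfold_in /=; apply/andP/imageP.
      by rewrite inE => -[E /eqP <-]; exists x; rewrite // inE mulNr -addr_eq0.
    by case=> [x']; rewrite inE mulNr -addr_eq0 => E [-> ->].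
  rewrite (bigD1 0) //= expr0n mulr0 -[Posz _]natz natrD natr_sum natz card_sqrt.
  rewrite (eq_bigr (fun=> 1 + e)) => [|y y0]; last first.
    by rewrite natz card_sqrt quad_charM quad_char_sqr ?mulr1.
  by rewrite sumr_const cardC1 /quad_char eqxx -mulr_natr -subn1 natrB ?natz; [ring | exact: ltnW (finNzRing_gt1 K)].
have Hs : \sum_t (binary_count b t)%:Z = q%:Z ^+ 2.
  transitivity (#|{: K * K}|)%:Z; last by rewrite card_prod PoszM.
  rewrite -sum1_card (partition_big (fun z => z.1 ^+ 2 + b * z.2 ^+ 2) xpredT) //=.
  rewrite -[Posz _]natz natr_sum; apply: eq_bigr => t' _.
  by rewrite sum1_card natz.
have q1 : q%:Z - 1 != 0 by rewrite subr_eq0 eqz_nat gtn_eqF ?finNzRing_gt1.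
have H1 : (binary_count b 1)%:Z = q%:Z - e.
  apply: (mulfI q1); apply: (addrI (binary_count b 0)%:Z).
  rewrite {2}H0; transitivity (q%:Z ^+ 2); last by ring.
  rewrite -Hs (bigD1 0) //=; congr (_ + _).
  rewrite (eq_bigr (fun=> (binary_count b 1)%:Z)) => [|y y0]; last first.
    by rewrite binary_count_const.
  by rewrite sumr_const cardC1 -mulr_natl -subn1 natrB ?natz // ltnW ?finNzRing_gt1.
have [->|t0] := eqVneq t 0; first by rewrite H0 mulr1n; ring.
by rewrite binary_count_const // H1 mulr0n; ring.
Qed.

End FiniteField.

(** * Counting zeros of diagonal forms *)

Section DiagonalForms.

Variable K : finFieldType.
Local Notation q := #|K|.

(** The number of solutions of [s_0 x_0^2 + s_1 x_1^2 + ... = t], coded by recursion so that leading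
    variables can be peeled off. *)
Fixpoint diag_count (s : seq K) (t : K) : nat :=
  if s is a :: s' then (\sum_x diag_count s' (t - a * x ^+ 2))%R else (t == 0).

Lemma mkseqS (f : nat -> K) n : mkseq f n.+1 = f 0%N :: mkseq (fun i => f i.+1) n.
Proof. by rewrite /mkseq /= (iotaDl 1 0) -map_comp. Qed.

Lemma card_diag_zeros n (f : nat -> K) (t : K) :
  #|[pred c : {ffun 'I_n -> K} | \sum_(i < n) f i * c i ^+ 2 == t]| =
  diag_count (mkseq f n) t.
Proof.
elim: n f t => [|n IHn] f t.
  rewrite /= (@eq_card _ _ (fun=> 0 == t)); last by move=> c; rewrite !inE big_ord0.
  rewrite eq_sym; case: eqP => _; last by rewrite card0.
  by rewrite (@eq_card _ _ predT) // cardT -cardE card_ffun card_ord expn0.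
rewrite mkseqS /= -sum1_card (partition_big (fun c : {ffun 'I_n.+1 -> K} => c ord0) xpredT) //=.
apply: eq_bigr => x _; rewrite -IHn sum1_card.
pose F (c : {ffun 'I_n -> K}) : {ffun 'I_n.+1 -> K} := [ffun i => oapp c x (unlift ord0 i)].
have FI : injective F.
  by move=> c c' /ffunP E; apply/ffunP=> i; have := E (lift ord0 i); rewrite !ffunE liftK.
rewrite -(card_image FI); apply: eq_card => c; rewrite unfold_in.
apply/andP/imageP=> [[/eqP E /eqP c0]|[c' E ->]].
  exists [ffun i => c (lift ord0 i)].
    rewrite inE /= -E big_ord_recl c0 [X in X - _]addrC addrK; apply/eqP.
    by apply: eq_bigr => i _; rewrite ffunE.
  by apply/ffunP=> i; rewrite ffunE; case: unliftP => [j ->|->] //=; rewrite ffunE.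
rewrite inE in E; split; last by rewrite ffunE unlift_none /=.
rewrite inE big_ord_recl ffunE unlift_none /= addrC eq_sym -subr_eq eq_sym -(eqP E); apply/eqP.
by apply: eq_bigr => i _; rewrite ffunE liftK.
Qed.

Lemma sum_diag_count s : (\sum_t diag_count s t)%N = (q ^ size s)%N.
Proof.
elim: s => [|a s IHs] /=.
  by rewrite (bigD1 0) //= eqxx big1 // => t /negPf->.
rewrite exchange_big /= expnS -sum_nat_const; apply: eq_bigr => x _.
by rewrite -IHs [RHS](reindex_inj (addIr (- (a * x ^+ 2)))).
Qed.

Hypothesis oddK : odd q.

(** Sorted by the value [t] of [x^2 + b y^2], the number of pairs is a constant plus a term at
    [t = 0]. The constant is met by all vectors for [s], the extra term only by the zeros of [s]. *)
Lemma diag_count_pair b s : b != 0 ->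
  (diag_count [:: 1, b & s] 0)%:Z =
  (q%:Z - quad_char (- b)) * q%:Z ^+ size s + q%:Z * quad_char (- b) * (diag_count s 0)%:Z.
Proof.
move=> b0 /=; rewrite pair_big /=.
rewrite (partition_big (fun z : K * K => z.1 ^+ 2 + b * z.2 ^+ 2) xpredT) //=.
rewrite -[Posz _]natz natr_sum.
rewrite (eq_bigr (fun t => (binary_count b t)%:Z * (diag_count s (- t))%:Z)); last first.
  move=> t _; rewrite -PoszM -natz; congr (_ %:R).
  rewrite /binary_count -sum_nat_const; apply: eq_bigr => z /eqP <-.
  by congr diag_count; ring.
under eq_bigr => t _ do rewrite (binary_countE oddK) // mulrDl.
rewrite big_split /= -mulr_sumr; congr (_ * _ + _).
  rewrite (reindex_inj oppr_inj) /=; under eq_bigr do rewrite opprK -natz.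
  by rewrite -natr_sum sum_diag_count natrX natz.
rewrite (bigD1 0) //= eqxx oppr0 mulr1 big1 ?addr0 // => t /negPf->.
by rewrite mulr0 mul0r.
Qed.

Lemma diag_count_zero m : diag_count (nseq m 0) 0 = (q ^ m)%N.
Proof.
elim: m => [|m IHm] /=; first by rewrite eqxx.
rewrite expnS -IHm -sum_nat_const; apply: eq_bigr => x _.
by rewrite mul0r subr0.
Qed.

(** Induction on half the rank, two coefficients at a time: the base pair [(1, d)] gives the sign
    [eta(- d)], and every pair [(1, 1)] multiplies it by [eta(-1)]. The factor [q] on the left
    avoids the exponents [r - 1] and [r/2 - 1], where [r = 2(h+1)]. *)
Lemma diag_count_coef h m (d : K) : d != 0 ->
  q%:Z * (diag_count (mkseq (diag_coef h.+1.*2 d) (h.+1.*2 + m)) 0)%:Z =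
  q%:Z ^+ m * (q%:Z ^+ h.+1.*2 + quad_char ((-1) ^+ h.+1 * d) * (q%:Z - 1) * q%:Z ^+ h.+1).
Proof.
move=> d0.
have step k b : b = (if k == 0%N then d else 1) ->
    mkseq (diag_coef k.+1.*2 d) (k.+1.*2 + m) = [:: 1, b & mkseq (diag_coef k.*2 d) (k.*2 + m)].
  move=> ->; rewrite doubleS !addSn !mkseqS; congr [:: _, _ & _].
  by case: k.
elim: h => [|h IHh].
  rewrite (step 0%N d) // diag_count_pair // size_mkseq expr1 mulN1r !add0n.
  have -> : mkseq (diag_coef 0 d) m = nseq m 0.
    by apply: (@eq_from_nth _ 0); rewrite ?size_mkseq ?size_nseq // => i im; rewrite nth_mkseq // nth_nseq im.
  rewrite diag_count_zero -[Posz (q ^ m)%N]natz natrX natz.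
  by ring.
rewrite (step h.+1 1) // diag_count_pair ?oner_neq0 // size_mkseq.
have -> : quad_char ((-1) ^+ h.+2 * d) = quad_char (-1 : K) * quad_char ((-1) ^+ h.+1 * d).
  by rewrite -quad_charM // mulrA -exprS.
set D := Posz (diag_count _ _) in IHh *; set e := quad_char (-1 : K).
transitivity (q%:Z * (q%:Z - e) * q%:Z ^+ (h.+1.*2 + m) + q%:Z * e * (q%:Z * D)).
  by ring.
rewrite IHh [h.+2.*2]doubleS; set k := h.+1.*2; clearbody k D.
rewrite (exprS _ k.+1) (exprS _ k) (exprS _ h.+1) exprD; set Q := Posz q.
by ring.
Qed.

End DiagonalForms.

(** * Diagonalization *)

Section NormalForm.

Variables (K : finFieldType) (V : vectType K) (B : V -> V -> K).
Hypothesis oddK : odd #|K|.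
Hypothesis B_sym : forall x y, B x y = B y x.
Hypothesis B_lin : forall a x y z, B (a *: x + y) z = a * B x z + B y z.

(** The codomain [K^o] is the field as a module over itself, so that the map is linear between
    vector spaces and has a kernel. *)
Definition bilin_fst z (x : V) : K^o := B x z.

Lemma bilin_fst_linear z : linear (bilin_fst z).
Proof. by move=> a x y; apply: B_lin. Qed.

HB.instance Definition _ z :=
  GRing.isLinear.Build K V K^o _ (bilin_fst z) (bilin_fst_linear z).

Definition orthv z : {vspace V} := lker (linfun (bilin_fst z)).

Lemma mem_orthv x z : (x \in orthv z) = (B x z == 0).
Proof. by rewrite memv_ker lfunE. Qed.

Lemma bilin0l z : B 0 z = 0.
Proof. by have := B_lin 1 0 0 z; rewrite scaler0 addr0 mul1r => /eqP; rewrite -subr_eq subrr => /eqP. Qed.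

Lemma bilinZl a x z : B (a *: x) z = a * B x z.
Proof. by rewrite -[a *: x]addr0 B_lin bilin0l addr0. Qed.

(** Orthogonal projection: [u - (B u v / B v v) v] is orthogonal to [v], while [v] itself is not. *)
Lemma orthv_basis (U : {vspace V}) v X : v \in U -> B v v != 0 ->
  basis_of (U :&: orthv v)%VS X -> basis_of U (v :: X).
Proof.
move=> vU Bv /andP[/eqP XU Xf]; apply/andP; split; last first.
  by rewrite free_cons Xf andbT XU memv_cap mem_orthv (negPf Bv) andbF.
rewrite span_cons XU eqEsubv subv_add -memvE vU capvSl /=.
apply/subvP=> u uU; apply/memv_addP.
exists ((B u v / B v v) *: v); first by rewrite memvZ ?memv_line.
exists (- (B u v / B v v) *: v + u); last by rewrite scaleNr addNKr.
rewrite memv_cap memvD ?memvZ // mem_orthv B_lin mulNr -mulrA mulVf // mulr1.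
by rewrite addNr eqxx.
Qed.

Lemma bilin_orthv a v x : x \in orthv v ->
  B (a *: v + x) (a *: v + x) = B v v * a ^+ 2 + B x x.
Proof.
rewrite mem_orthv => /eqP Bxv.
by rewrite B_lin !(B_sym _ (_ + _)) !B_lin (B_sym v) Bxv; ring.
Qed.

(* Split off a vector [v] of the restriction to [U] with [B v v = 1]. When there
   is none, the form vanishes on the complement of any anisotropic [v], because
   a nondegenerate binary form represents 1. *)
Lemma exists_diag_basis (U : {vspace V}) : exists r d (X : seq V),
  [/\ (r <= size X)%N, d != 0, basis_of U X & forall c : nat -> K,
    let u := \sum_(i < size X) c i *: X`_i in
    B u u = \sum_(i < size X) diag_coef r d i * c i ^+ 2].
Proof.
have [n] := ubnP (\dim U); elim: n U => // n IHn U /ltnSE dimU.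
have sumU (X : seq V) W (c : nat -> K) : basis_of W X -> \sum_(i < size X) c i *: X`_i \in W.
  move=> XW; apply: memv_suml => i _; rewrite memvZ //.
  by apply: (basis_mem XW); apply: mem_nth.
have zero0 (W : {vspace V}) : (forall w, w \in W -> B w w = 0) -> forall c : nat -> K,
    let u := \sum_(i < size (vbasis W)) c i *: (vbasis W)`_i in B u u = 0.
  by move=> W0 c /=; apply: W0; exact: (sumU _ _ c (vbasisP W)).
have diagS r d i : (0 < r)%N -> diag_coef r.+1 d i.+1 = diag_coef r d i :> K by case: r.
have diag0 r d : (0 < r)%N -> diag_coef r.+1 d 0 = 1 :> K by case: r.
have diag1 d i : diag_coef 1 d i.+1 = 0 :> K by [].
(* In the totally isotropic case the rank is 0 and [d = 1] is a placeholder, since [d] must be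
   nonzero. *)
have [U0|] := pselect (forall u, u \in U -> B u u = 0).
  exists 0%N, 1, (vbasis U); split; rewrite ?oner_neq0 ?vbasisP // => c /=.
  by rewrite zero0 // big1 // => i _; rewrite /diag_coef mul0r.
have ltU v : v \in U -> B v v != 0 -> (\dim (U :&: orthv v) < n)%N.
  move=> vU Bv; apply: leq_trans dimU.
  have /(@size_basis _ _ _ _ (in_tuple (v :: _)))-> := orthv_basis vU Bv (vbasisP _).
  by rewrite /= size_tuple.
have cons v X (c : nat -> K) : v \in U -> basis_of (U :&: orthv v)%VS X ->
    let u := \sum_(i < (size X).+1) c i *: (v :: X)`_i in
    let u' := \sum_(i < size X) c i.+1 *: X`_i in
    B u u = B v v * c 0%N ^+ 2 + B u' u'.
  move=> vU Xb /=; rewrite big_ord_recl /= bilin_orthv //.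
  by have := sumU X _ (fun i => c i.+1) Xb; rewrite memv_cap => /andP[].
have [[v [vU Bv1]] _|no1 nU0] := pselect (exists v, v \in U /\ B v v = 1).
  have Bv : B v v != 0 by rewrite Bv1 oner_neq0.
  have [r [d [X [rX d0 Xb Xd]]]] := IHn _ (ltU v vU Bv).
  (* If the complement has rank 0, the last nonzero coefficient becomes [B v v = 1]; otherwise this
     1 goes in front and [d] stays last. *)
  have [r0|r0] := posnP r.
    exists 1%N, 1, (v :: X); split; rewrite ?oner_neq0 ?orthv_basis // => c.
    rewrite /= cons // Bv1 mul1r (Xd (fun i => c i.+1)) big_ord_recl /= mul1r.
    by congr (_ + _); apply: eq_bigr => i _; rewrite diag1 r0.
  exists r.+1, d, (v :: X); split; rewrite ?orthv_basis // => c.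
  rewrite /= cons // Bv1 mul1r (Xd (fun i => c i.+1)) big_ord_recl /=.
  rewrite diag0 // mul1r.
  by congr (_ + _); apply: eq_bigr => i _; rewrite diagS.
have [v [vU Bv]] : exists v, v \in U /\ B v v != 0.
  apply: contrapT => no; apply: nU0 => u uU; apply/eqP/negPn/negP => Bu.
  by apply: no; exists u.
exists 1%N, (B v v), (v :: vbasis (U :&: orthv v)%VS).
split; rewrite ?orthv_basis ?vbasisP // => c.
rewrite /= cons ?vbasisP // (zero0 _ _ (fun i => c i.+1)); last first.
  move=> w; rewrite memv_cap => /andP[wU wv]; apply/eqP/negPn/negP=> Bw.
  apply: no1; have [x [y xy]] := binary_form_surj oddK 1 Bv Bw.
  exists (x *: v + y *: w); split; first by rewrite memvD ?memvZ.
  rewrite bilin_orthv -?xy; last by rewrite memvZ.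
  by rewrite bilinZl B_sym bilinZl; ring.
by rewrite big_ord_recl /= big1 // => i _; rewrite diag1 mul0r.
Qed.

Lemma normal_form_exists : exists r d, (r <= \dim {:V})%N /\
  normal_form (fun x => B x x) r d.
Proof.
have [r [d [X [rX d0 Xb Xd]]]] := exists_diag_basis {:V}.
have sX : size X = \dim {:V} by rewrite (@size_basis _ _ _ _ (in_tuple X) Xb).
exists r, d; split; rewrite -?sX //; split=> //.
rewrite -sX; exists (in_tuple X) => // x.
(* The coordinates are extended by 0 to all natural indices, as the diagonal basis expects. *)
pose c j := oapp (fun i => coord (in_tuple X) i x) 0 (insub j : option 'I_(size X)).
have cE (i : 'I_(size X)) : c i = coord (in_tuple X) i x.
  by rewrite /c valK.
rewrite {1 2}(@coord_basis _ _ _ _ (in_tuple X) x Xb (memvf x)) /=.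
under eq_bigr do rewrite -cE.
under [RHS]eq_bigr do rewrite -cE.
exact: Xd.
Qed.

End NormalForm.

(** One normal form within the index bound makes [pick] succeed, so rank and type are read off a
    genuine normal form and not off the default. *)
Lemma qrank_normal_form (K : finFieldType) (V : vectType K) (Q : V -> K) r d :
  (r <= \dim {:V})%N -> normal_form Q r d ->
  exists2 d', normal_form Q (qrank Q) d' & qtype Q = if qrank Q == 0%N then 1 else quad_char d'.
Proof.
move=> rN Qrd; exists (normal_data Q).2 => //.
rewrite /qrank /normal_data; case: pickP => [[r' d'] /asboolP //|].
by move=> /(_ (Ordinal (rN : (r < _.+1)%N), d)) /asboolP[].
Qed.

(** * Orbits of a similarity *)

(** Multiplication by [c] has only orbits of length [M] on nonzero elements, since [c^k x = x]
    forces [c^k = 1]; [S] is a union of such orbits. *)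
Lemma dvdn_prim_root_orbits (T : finFieldType) M (c : T) (S : {pred T}) :
  M.-primitive_root c -> 0 \notin S -> (forall x, x \in S -> c * x \in S) -> (M %| #|S|)%N.
Proof.
move=> cP S0 cS; have M0 := prim_order_gt0 cP.
have c0 : c != 0.
  apply/eqP=> c0; have /eqP := prim_expr_order cP.
  by rewrite c0 expr0n gtn_eqF // eq_sym oner_eq0.
have iterE k x : iter k ( *%R c) x = c ^+ k * x.
  by elim: k => [|k IHk] /=; rewrite ?expr0 ?mul1r // IHk exprS mulrA.
have ordE x : x != 0 -> fingraph.order ( *%R c) x = M.
  move=> x0; have Mo : (M %| fingraph.order ( *%R c) x)%N.
    rewrite (prim_order_dvd cP); apply/eqP/(mulIf x0); rewrite mul1r -iterE.
    exact: (fingraph.iter_order (mulfI c0)).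
  apply/eqP; rewrite eqn_leq (dvdn_leq _ Mo) ?fingraph.order_gt0 // andbT leqNgt.
  apply/negP=> /findex_iter; rewrite iterE (prim_expr_order cP) mul1r findex0.
  by move=> E; rewrite -E in M0.
rewrite -(@fcard_order_set _ _ (mulfI c0) M S) ?dvdn_mull //.
  by apply/subsetP=> x xS; rewrite inE ordE //; apply: contraTneq xS => ->.
(* Stability under [c] gives stability under its inverse [c ^+ M.-1]. *)
move=> x _ /eqP <-; apply/idP/idP=> [/cS //|xS].
have -> : x = iter M.-1 ( *%R c) (c * x).
  by rewrite iterE mulrA -exprSr prednK // (prim_expr_order cP) mul1r.
by elim: M.-1 => //= k; apply: cS.
Qed.

(** Testing with [y = 0] shows that the form vanishes at [c]; the [i]-th unit vector then leaves
    [2 a_i c_i = 0]. *)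
Lemma diag_radical (K : fieldType) n (a c : 'I_n -> K) : 2 != 0 :> K ->
  (forall y : 'I_n -> K, \sum_(i < n) a i * (c i + y i) ^+ 2 = \sum_(i < n) a i * y i ^+ 2) ->
  forall i, a i * c i = 0.
Proof.
move=> two0 H i.
have H0 : \sum_(j < n) a j * c j ^+ 2 = 0.
  have := H (fun=> 0); rewrite [RHS]big1 => [E|j _]; last by rewrite expr0n mulr0.
  by rewrite -[RHS]E; apply: eq_bigr => j _; rewrite addr0.
have := H (fun j => (j == i)%:R).
rewrite (eq_bigr (fun j => a j * c j ^+ 2 + (2 * (a j * c j) * (j == i)%:R
  + a j * (j == i)%:R ^+ 2))) => [|j _]; last by ring.
rewrite !big_split /= H0 add0r -[RHS]add0r => /addIr.
rewrite (bigD1 i) //= eqxx mulr1 big1 => [|j /negPf->]; last by rewrite mulr0.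
by rewrite addr0 => /eqP; rewrite mulf_eq0 (negPf two0) => /eqP.
Qed.

(** * Zeros and radical of a form in normal form *)

Section NormalFormCount.

Variables (K : finFieldType) (V : vectType K) (Q : V -> K) (r : nat) (d : K).
Hypothesis Qrd : normal_form Q r d.
Local Notation N := (\dim {:V}).
Local Notation T := (finvect_type V).

(** Coordinates in the basis of the normal form identify [V] with [K^N]; [T] is [V] as a finite
    type, on which cardinals make sense. *)
Lemma normal_form_coords : exists2 F : {ffun 'I_N -> K} -> T, bijective F &
  [/\ F 0 = 0, {morph F : x y / x + y} &
    forall c, Q (F c) = \sum_(i < N) diag_coef r d i * c i ^+ 2].
Proof.
have [d0 [b bV bQ]] := Qrd.
have bf : free b by case/andP: bV.
exists (fun c : {ffun 'I_N -> K} => \sum_(i < N) c i *: b`_i : T).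
  exists (fun x : T => [ffun i => coord b i (x : V)] : {ffun 'I_N -> K}).
    by move=> c; apply/ffunP=> i; rewrite ffunE coord_sum_free.
  by move=> x; rewrite [RHS](coord_basis bV (memvf x)); apply: eq_bigr => i _; rewrite ffunE.
split=> [|c c'|c].
- by rewrite big1 // => i _; rewrite ffunE scale0r.
- by rewrite -big_split; apply: eq_bigr => i _; rewrite ffunE scalerDl.
by rewrite bQ; apply: eq_bigr => i _; rewrite coord_sum_free.
Qed.

Lemma normal_form0 : Q 0 = 0.
Proof.
have [F _ [F0 _ FQ]] := normal_form_coords.
rewrite -[0](F0 : _ = (0 : V)) FQ big1 // => i _; by rewrite ffunE expr0n mulr0.
Qed.

Lemma card_normal_form_zeros :
  #|[pred x : T | Q x == 0]| = diag_count (mkseq (diag_coef r d) N) 0.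
Proof.
have [F Fb [_ _ FQ]] := normal_form_coords.
rewrite -card_diag_zeros -(card_image (bij_inj Fb)); apply: eq_card => x.
have [G FK GK] := Fb.
rewrite inE -[x]GK FQ; apply/idP/imageP=> [E|[c E /(bij_inj Fb)->]]; last by rewrite inE in E.
by exists (G x).
Qed.

(** The radical consists of the vectors whose first [r] coordinates vanish. Describing it by
    translation invariance of [Q] makes its stability under similarities immediate. *)
Lemma card_normal_form_radical : 2 != 0 :> K -> (r <= N)%N ->
  #|[pred x : T | [forall y : T, Q (x + y) == Q y]]| = (#|K| ^ (N - r))%N.
Proof.
move=> two0 rN; have [d0 _] := Qrd.
have [F Fb [F0 FD FQ]] := normal_form_coords; have [G FK GK] := Fb.
have coef0 i : (diag_coef r d i == 0) = (r <= i)%N.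
  rewrite /diag_coef; case: ltngtP => [||<-]; rewrite ?oner_eq0 ?(negPf d0) ?ltnn ?eqxx //.
    by move=> lt; rewrite leqNgt (ltnW lt).
pose R (i : 'I_N) : pred K := if (i < r)%N then pred1 0 else predT.
transitivity #|family R|.
  rewrite -(card_image (bij_inj Fb)); apply: eq_card => x.
  rewrite inE -[x]GK mem_image; last exact: bij_inj.
  set c := G x; apply/forallP/familyP => [H i|H y]; last first.
    rewrite -[y]GK -FD !FQ; apply/eqP/eq_bigr => i _; rewrite ffunE.
    have := H i; rewrite /R; case: ltnP; first by rewrite inE => _ /eqP->; rewrite add0r.
    by rewrite -coef0 => /eqP-> _; rewrite !mul0r.
  rewrite /R; case: ltnP => // ir; rewrite inE.
  have := diag_radical two0 (a := fun i => diag_coef r d i) (c := c) _ i.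
  move=> /(_ _)/eqP; rewrite mulf_eq0 coef0 leqNgt ir /=; apply=> y.
  have /eqP := H (F (finfun y)); rewrite -FD !FQ => E.
  under [RHS]eq_bigr => j _ do rewrite -[y j]ffunE.
  by rewrite -[RHS]E; apply: eq_bigr => j _; rewrite !ffunE.
rewrite card_family foldrE big_map big_enum /=.
transitivity (\prod_(0 <= i < N) (if (i < r)%N then 1 else #|K|))%N.
  rewrite big_mkord; apply: eq_bigr => i _; rewrite /R.
  by case: ifP; rewrite ?card1.
rewrite (@big_cat_nat _ _ _ r) //= big_nat big1 ?mul1n => [|i /andP[_ ->] //].
rewrite big_nat (eq_bigr (fun=> #|K|)) => [|i /andP[ri _]]; last by rewrite ltnNge ri.
by rewrite -big_nat prod_nat_const_nat.
Qed.

End NormalFormCount.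

(** * Powers of p modulo p^D + 1 *)

(** As [p^D = -1] modulo [p^D + 1], the exponent can be lowered by [2D]. For [0 < l < D] the number
    [p^l - 1] is too small, and for [D <= l < 2D] the modulus would divide the smaller number
    [p^(l-D) + 1]. *)
Lemma dvdn_expS_pred p D l : (1 < p)%N -> (0 < D)%N ->
  (p ^ D + 1 %| p ^ l - 1)%N -> (2 * D %| l)%N.
Proof.
move=> p1 D0; have p0 k : (0 < p ^ k)%N by rewrite expn_gt0 ltnW.
elim/ltn_ind: l => l IH dl.
have [lD|Dl] := ltnP l D.
  have ltp : (p ^ l < p ^ D)%N by rewrite ltn_exp2l.
  have [pl0|pl0] := posnP (p ^ l - 1)%N; last by have := dvdn_leq pl0 dl; lia.
  have [->|l0] := posnP l; first exact: dvdn0.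
  by have := ltn_exp2l 0 l p1; rewrite expn0 l0; lia.
have step k : (p ^ (D + k) + p ^ k = (p ^ D + 1) * p ^ k)%N by rewrite expnD mulnDl mul1n.
have [l2D|D2l] := ltnP l (2 * D).
  have dl' : (p ^ D + 1 %| p ^ (l - D) + 1)%N.
    have E : ((p ^ l - 1) + (p ^ (l - D) + 1) = (p ^ D + 1) * p ^ (l - D))%N.
      by rewrite -step subnKC //; have := p0 l; lia.
    by rewrite -(dvdn_addr _ dl) E dvdn_mulr.
  have := dvdn_leq _ dl'; rewrite !addn1 => /(_ isT).
  by rewrite ltnS leq_exp2l //; lia.
have lE : l = (2 * D + (l - 2 * D))%N by rewrite subnKC.
rewrite lE dvdn_addr // IH //; first by lia.
have E : ((p ^ l - 1) = (p ^ D + 1) * (p ^ D - 1) * p ^ (l - 2 * D) + (p ^ (l - 2 * D) - 1))%N.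
  rewrite {1}lE expnD mul2n -addnn expnD.
  have := p0 D; have := p0 (l - 2 * D)%N.
  move: (p ^ D)%N (p ^ (l - 2 * D))%N => [|x] [|y] // _ _; rewrite !subn1 /=; nia.
by move: dl; rewrite E dvdn_addr // -mulnA dvdn_mulr.
Qed.

(** Here [p^(2D) - 1 = (p^D + 1)(p^D - 1)] and [p - 1] divides [p^D - 1]. *)
Lemma dvdn_expS_mul_pred p D k :
  ((p ^ D + 1) * (p - 1) %| p ^ (2 * D * k) - 1)%N.
Proof.
rewrite expnM.
apply: (@dvdn_trans (p ^ (2 * D) - 1)); last by rewrite !subn1 dvdn_pred_predX.
have -> : (p ^ (2 * D) - 1 = (p ^ D + 1) * (p ^ D - 1))%N.
  by rewrite mulnC expnM -(exp1n 2) subn_sqr mulnC exp1n.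
by rewrite dvdn_mul // !subn1 dvdn_pred_predX.
Qed.

(* Here [Z] is the number of zeros of a form of rank [2 D rho] and nullity
   [2 D k]. Modulo [p ^ D + 1] one has [p ^ D = -1], so the relation forces
   [tau * (-1) ^+ rho = 1]. *)
Lemma zero_count_sign p D k rho (tau : int) (Z : nat) :
  (1 < p)%N -> (0 < D)%N -> tau = 1 \/ tau = -1 -> (0 < Z)%N ->
  ((p ^ D + 1) * (p - 1) %| Z - 1)%N ->
  p%:Z * Z%:Z = p%:Z ^+ (k * (2 * D)) *
    (p%:Z ^+ (rho * (2 * D)) + tau * (p%:Z - 1) * p%:Z ^+ (rho * D)) ->
  tau = (-1) ^+ rho.
Proof.
move=> p1 D0 tau2 Z0 MZ HZ.
have PX i : p%:Z ^+ i = (p ^ i)%:Z by rewrite -[Posz (p ^ i)%N]natz natrX natz.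
have pD_mod i : (p%:Z ^+ D + 1 %| (p%:Z ^+ D) ^+ i - (-1) ^+ i)%Z.
  by rewrite -[1]opprK subrXX dvdz_mulr.
have ME : (p%:Z ^+ D + 1) * (p%:Z - 1) = ((p ^ D + 1) * (p - 1))%:Z.
  by rewrite PoszM PoszD PX subzn // ltnW.
have MZ' : ((p%:Z ^+ D + 1) * (p%:Z - 1) %| Z%:Z - 1)%Z by rewrite ME (subzn Z0) dvdzE !absz_nat.
have Mp : ((p%:Z ^+ D + 1) * (p%:Z - 1) %| p%:Z ^+ (2 * D * (k + rho)) - 1)%Z.
  have p0 := ltnW p1; have pX0 : (0 < p ^ (2 * D * (k + rho)))%N by rewrite expn_gt0 p0.
  rewrite ME PX (subzn pX0) dvdzE !absz_nat; exact: dvdn_expS_mul_pred.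
(* By the relation for [p Z], the number [p (Z - 1) - (p^(2D(k+rho)) - 1)] equals [p - 1] times the
   quantity here, so a factor [p - 1] cancels. *)
have key : (p%:Z ^+ D + 1 %| tau * (p%:Z ^+ D) ^+ (2 * k + rho) - 1)%Z.
  have pn1 : p%:Z - 1 != 0 by rewrite subr_eq0 eqz_nat gtn_eqF.
  rewrite -(dvdz_mul2r pn1).
  have -> : (tau * (p%:Z ^+ D) ^+ (2 * k + rho) - 1) * (p%:Z - 1) =
      p%:Z * (Z%:Z - 1) - (p%:Z ^+ (2 * D * (k + rho)) - 1).
    rewrite [p%:Z * (Z%:Z - 1)]mulrBr HZ.
    have -> : (2 * D * (k + rho) = k * (2 * D) + rho * (2 * D))%N by rewrite mulnC mulnDl.
    have -> : (p%:Z ^+ D) ^+ (2 * k + rho) = p%:Z ^+ (k * (2 * D)) * p%:Z ^+ (rho * D).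
      by rewrite -exprM -exprD; congr (_ ^+ _); lia.
    rewrite exprD; move: (p%:Z ^+ _) (p%:Z ^+ _) (p%:Z ^+ _) => x y z; ring.
  by rewrite rpredB // dvdz_mull.
have : (p%:Z ^+ D + 1 %| tau * (-1) ^+ rho - 1)%Z.
  have -> : tau * (-1) ^+ rho - 1 = (tau * (p%:Z ^+ D) ^+ (2 * k + rho) - 1)
      - tau * ((p%:Z ^+ D) ^+ (2 * k + rho) - (-1) ^+ (2 * k + rho)).
    rewrite [(-1) ^+ (_ + _)]exprD exprM sqrrN !expr1n mul1r.
    move: (_ ^+ (2 * k + rho)) => x; ring.
  by rewrite rpredB // dvdz_mull.
(* The difference [tau (-1)^rho - 1] is 0 or -2, and a modulus above 2 excludes -2. *)
have pD : (2 < p ^ D + 1)%N.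
  by rewrite addn1 ltnS (leq_trans p1) // -[X in (X <= _)%N]expn1 leq_exp2l.
rewrite dvdzE PX -PoszD absz_nat -signr_odd.
by case: tau2 => ->; case: (odd rho) => //= /dvdn_leq => /(_ isT); rewrite leqNgt pD.
Qed.

(** * Nullity and type of a form with a similarity *)

Lemma similarity_nullity_type p (L : fieldExtType 'F_p) (Q : L -> 'F_p) r e D (c : L) (s : 'F_p) :
  prime p -> odd p -> (r <= \dim {:L})%N -> normal_form Q r e ->
  (0 < D)%N -> (2 * D %| \dim {:L})%N ->
  ((p ^ D + 1) * (p - 1)).-primitive_root c -> s != 0 -> (forall x, Q (c * x) = s * Q x) ->
  (2 * D %| \dim {:L} - r)%N /\
  ((0 < r)%N -> quad_char e = (-1) ^+ ((((p - 1)./2 * D) + 1) * (r %/ (2 * D)))).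
Proof.
move=> p_pr p_odd rN Qre D0 dN cP s0 Qc.
set N := \dim {:L} in rN dN *; set M := ((p ^ D + 1) * (p - 1))%N in cP.
have p1 := prime_gt1 p_pr.
have cK : #|'F_p| = p by rewrite card_Fp.
have oddK : odd #|'F_p| by rewrite cK.
have two0 := odd_card_two_neq0 oddK.
have e0 : e != 0 by case: Qre.
have c0 : c != 0.
  apply/eqP=> c0; have /eqP := prim_expr_order cP.
  by rewrite c0 expr0n gtn_eqF ?(prim_order_gt0 cP) // eq_sym oner_eq0.
pose T : finFieldType := finvect_type L.
have zc : #|[pred x : T | Q x == 0]| = diag_count (mkseq (diag_coef r e) N) 0.
  exact: card_normal_form_zeros.
have rc : #|[pred x : T | [forall y : T, Q (x + y) == Q y]]| = (p ^ (N - r))%N.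
  by rewrite (card_normal_form_radical Qre) // cK.
(* The subtracted 1 accounts for the zero vector, the only fixed point. *)
have orbits (S : {pred T}) : 0 \in S -> (forall x, x \in S -> c * x \in S) -> (M %| #|S| - 1)%N.
  move=> S0 Sc; rewrite (cardD1 (0 : T)) S0 addKn.
  apply: (@dvdn_prim_root_orbits T M c) => //; first by rewrite !inE eqxx.
  by move=> x; rewrite !inE => /andP[x0 /Sc->]; rewrite mulf_neq0.
have MZ : (M %| diag_count (mkseq (diag_coef r e) N) 0%R - 1)%N.
  rewrite -zc; apply: orbits => [|x]; rewrite !inE ?(normal_form0 Qre) //.
  by rewrite Qc => /eqP->; rewrite mulr0.
have MR : (M %| p ^ (N - r) - 1)%N.
  rewrite -rc; apply: orbits => [|x]; rewrite !inE.
    by apply/forallP=> y; rewrite add0r.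
  move=> /forallP H; apply/forallP => y.
  (* This turns [Q (c x + y)] into [s Q (x + c^-1 y)], to which the invariance under [x] applies. *)
  have -> : y = c * (c^-1 * y) by rewrite mulVKf.
  by rewrite -mulrDr !Qc (eqP (H _)).
have dl : (2 * D %| N - r)%N.
  by apply: (@dvdn_expS_pred p) => //; apply: dvdn_trans MR; apply: dvdn_mulr.
split=> // r0.
have dr : (2 * D %| r)%N by rewrite -(dvdn_addr _ dl) subnK.
case/dvdnP: dr => rho rE; case/dvdnP: dl => k lE.
have rho0 : (0 < rho)%N by move: r0; rewrite rE muln_gt0 => /andP[].
rewrite rE mulnK ?muln_gt0 //.
(* Half the rank is [rho * D], written as a successor to fit the zero count for rank [h.+1.*2]. *)
have [h hE] : exists h, (rho * D = h.+1)%N.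
  by exists (rho * D).-1; rewrite prednK // muln_gt0 rho0.
have rE' : r = h.+1.*2 by rewrite rE -hE mulnCA mul2n.
have := diag_count_coef oddK h (N - r) e0.
rewrite -rE' subnKC // cK.
set Z := diag_count _ _ in MZ *; set tau := quad_char _ => HZ.
have tau2 : tau = 1 \/ tau = -1.
  rewrite /tau /quad_char mulf_eq0 (negPf e0) orbF expf_eq0 oppr_eq0 oner_eq0 andbF.
  by case: ifP; [left|right].
(* The zero count involves [tau = eta((-1)^(r/2) e)]; since [eta(-1) = (-1)^((p-1)/2)], the type
   [eta(e)] is recovered from it. *)
have quad_e : quad_char e = (-1) ^+ ((p - 1)./2 * (rho * D)) * tau.
  have sg i : quad_char ((-1 : 'F_p) ^+ i) = (-1) ^+ ((p - 1)./2 * i).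
    elim: i => [|i IHi]; last first.
      by rewrite exprS quad_charM // IHi quad_charN1 // cK -subn1 -exprD mulnS.
    by have := quad_char_sqr (oner_neq0 'F_p); rewrite expr1n muln0 !expr0.
  by rewrite /tau hE quad_charM // sg mulrA -exprD addnn -mul2n exprM sqrrN !expr1n mul1r.
suff tauE : tau = (-1) ^+ rho.
  by rewrite quad_e tauE -exprD mulnDl mul1n (mulnC rho) mulnA.
apply: (@zero_count_sign p D k rho _ Z) => //.
- by rewrite /Z -zc (cardD1 (0 : T)) inE (normal_form0 Qre) eqxx.
- by rewrite -lE (_ : (rho * (2 * D))%N = r) // hE.
Qed.

(** * Trace forms *)

Section TraceForm.

Variables (p : nat) (L : fieldExtType 'F_p).
Hypothesis p_pr : prime p.

Lemma pchar_ext : p \in [pchar L].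
Proof. by rewrite (pchar_lalg L) pchar_Fp. Qed.

Lemma exprpD (x y : L) i : (x + y) ^+ (p ^ i) = x ^+ (p ^ i) + y ^+ (p ^ i).
Proof. by apply: exprDn_pchar; rewrite (eq_pnat _ (pcharf_eq pchar_ext)) pnatX pnat_id. Qed.

Lemma exprpZ (a : 'F_p) (x : L) i : (a *: x) ^+ (p ^ i) = a *: x ^+ (p ^ i).
Proof.
rewrite exprZn; congr (_ *: _); elim: i => // i IHi.
by rewrite expnSr exprM IHi -[X in _ ^+ X = _](card_Fp p_pr) expf_card.
Qed.

Lemma abs_trace_linear (a : 'F_p) (x y : L) :
  abs_trace (a *: x + y) = a * abs_trace x + abs_trace y.
Proof.
apply: (fmorph_inj (in_alg L)); rewrite rmorphD rmorphM /= !abs_traceE //.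
rewrite -scalerAl mul1r scaler_sumr -big_split /=.
by apply: eq_bigr => i _; rewrite exprpD exprpZ.
Qed.

Lemma abs_traceZ (a : 'F_p) (x : L) : abs_trace (a *: x) = a * abs_trace x.
Proof.
apply: (fmorph_inj (in_alg L)); rewrite rmorphM /= !abs_traceE //.
by rewrite -scalerAl mul1r scaler_sumr; apply: eq_bigr => i _; rewrite exprpZ.
Qed.

Lemma frobenius_fixed (x : L) : x ^+ p = x -> exists s : 'F_p, x = s%:A.
Proof.
move=> xp; suff /vlineP[s ->] : x \in (1%AS : {vspace L}) by exists s.
by rewrite (Fermat's_little_theorem 1%AS x) dimv1 expn1 card_Fp // xp.
Qed.

Lemma trace_form_similarity k (a : 'I_k -> L) (alpha : 'I_k -> nat) D c :
  (forall i, exists2 m, odd m & alpha i = (D * m)%N) ->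
  ((p ^ D + 1) * (p - 1)).-primitive_root c ->
  exists2 s : 'F_p, s != 0 & forall x : L,
    let Q := trace_form (\sum_(i < k) a i *: 'X^(p ^ alpha i + 1)) in Q (c * x) = s * Q x.
Proof.
move=> alphaE cP; have p1 := prime_gt1 p_pr.
have cM := prim_expr_order cP.
(* The [(p-1)]-th power of this element is [c^M = 1], with [M] the order of [c], so Frobenius fixes
   it. *)
have [s sE] : exists s : 'F_p, c ^+ (p ^ D + 1) = s%:A.
  by apply: frobenius_fixed; rewrite -[X in _ ^+ X](subnK (ltnW p1)) exprD expr1 -exprM cM mul1r.
have c0 : c != 0.
  apply/eqP=> c0; have /eqP := cM.
  by rewrite c0 expr0n gtn_eqF ?(prim_order_gt0 cP) // eq_sym oner_eq0.
have s0 : s != 0.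
  by apply: contraNneq (expf_neq0 (p ^ D + 1) c0) => s0; rewrite sE s0 scale0r.
have c2D j : c ^+ (p ^ (2 * D * j)) = c.
  have p0 : (0 < p ^ (2 * D * j))%N by rewrite expn_gt0 ltnW.
  rewrite -(subnK p0) exprD expr1.
  case/dvdnP: (dvdn_expS_mul_pred p D j) => u ->.
  by rewrite mulnC exprM cM expr1n mul1r.
exists s => // x /=; rewrite /trace_form -abs_traceZ; congr abs_trace.
rewrite !horner_sum scaler_sumr; apply: eq_bigr => i _.
rewrite !hornerZ !hornerXn exprMn.
have [m m_odd ->] := alphaE i.
have -> : c ^+ (p ^ (D * m) + 1) = s%:A.
  rewrite -sE !exprD; congr (_ * _).
  (* Since [m] is odd, [D m] is [D] plus a multiple of [2D], and raising to the power [p^(2Dj)]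
     fixes [c]. *)
  have -> : (D * m = 2 * D * m./2 + D)%N by rewrite -{1}(odd_double_half m) m_odd; lia.
  by rewrite expnD exprM c2D.
by rewrite mulrCA mulr_algl.
Qed.

Hypothesis p_odd : odd p.

(** The trace form is the diagonal of the symmetric bilinear form [B] below, where [2^-1]
    compensates for the two equal terms at [y = x]. *)
Lemma trace_form_normal_form k (a : 'I_k -> L) (alpha : 'I_k -> nat) :
  exists r d, (r <= \dim {:L})%N /\
    normal_form (trace_form (\sum_(i < k) a i *: 'X^(p ^ alpha i + 1))) r d.
Proof.
have oddK : odd #|'F_p| by rewrite card_Fp.
pose B (x y : L) := 2^-1 * abs_trace (\sum_(i < k) a i * (x ^+ (p ^ alpha i) * y + x * y ^+ (p ^ alpha i))).
have [x y|b x y z|r [d [rN Brd]]] := @normal_form_exists _ L B oddK.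
- by rewrite /B; congr (_ * abs_trace _); apply: eq_bigr => i _; congr (_ * _); ring.
- rewrite /B mulrCA -mulrDr -abs_trace_linear scaler_sumr -big_split.
  congr (_ * abs_trace _); apply: eq_bigr => i _ /=.
  by rewrite exprpD exprpZ !mulrDl -!scalerAl !mulrDr -!scalerAr scalerDr addrACA.
exists r, d; split=> //.
suff -> : trace_form (\sum_(i < k) a i *: 'X^(p ^ alpha i + 1)) = (fun x => B x x) by [].
apply/funext => x; rewrite /trace_form /B horner_sum.
set u := \sum_(i < k) _; set v := \sum_(i < k) _.
have -> : v = 2 *: u.
  rewrite scaler_sumr; apply: eq_bigr => i _.
  by rewrite hornerZ hornerXn exprD expr1 scaler_nat; ring.
by rewrite abs_traceZ mulrA mulVf ?mul1r // odd_card_two_neq0.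
Qed.

End TraceForm.

(** * Nullity and type of the trace form of f *)

Theorem theorem7p3 (p : nat) (hp : prime p) (hodd : odd p)
    (n : nat) (hn : (0 < n)%N)
    (L : fieldExtType 'F_p) (hL : \dim {:L} = n)
    (k : nat) (hk : (0 < k)%N)
    (a : 'I_k -> L) (alpha : 'I_k -> nat)
    (halpha : forall i j : 'I_k, (i < j)%N -> (alpha i < alpha j)%N)
    (ha : forall i : 'I_k, i.+1 = k -> a i != 0)
    (nu : nat) (hnu : forall i : 'I_k, nu2 (alpha i) = Some nu)
    (hnun : (nu < logn 2 n)%N)
    (f : {poly L}) (hf : f = \sum_(i < k) a i *: 'X^(p ^ alpha i + 1)) :
  [/\ (2 ^ (nu + 1) %| trace_nullity f)%N,
      trace_type f = (-1) ^+ (((p - 1) ^ 2 %/ 4 * 2 ^ nu + 1)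
                        * ((n - trace_nullity f) %/ 2 ^ (nu + 1)))
    & trace_type f = (if nu == 0%N then
                (-1) ^+ (((p - 1) ^ 2 %/ 4 + 1)
                           * ((n - trace_nullity f) %/ 2 ^ (nu + 1)))
              else (-1) ^+ ((n - trace_nullity f) %/ 2 ^ (nu + 1)))].
Proof.
set D := (2 ^ nu)%N; have D0 : (0 < D)%N by rewrite expn_gt0.
have DE : (2 ^ (nu + 1) = 2 * D)%N by rewrite addn1 expnS.
have dN : (2 * D %| n)%N by rewrite -DE addn1 pfactor_dvdn.
have alphaE i : exists2 m, odd m & alpha i = (D * m)%N.
  have := hnu i; rewrite /nu2; case: eqVneq => // ai0 [nuE].
  have [|m m_odd mE] := @pfactor_coprime 2 (alpha i) isT; first by rewrite lt0n.
  exists m; first by rewrite -coprime2n.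
  by rewrite mulnC /D -nuE.
(* The order [(p^D + 1)(p - 1)] divides [p^n - 1] because [2D] divides [n]. *)
have [c cP] : exists c : L, ((p ^ D + 1) * (p - 1)).-primitive_root c.
  have [|c cP] := @finField_prim_root_dvd (finvect_type L) ((p ^ D + 1) * (p - 1)).
    have -> : #|finvect_type L| = (p ^ n)%N.
      rewrite -hL -[X in (X ^ _)%N](card_Fp hp) -(@card_vspace _ (finvect_type L)).
      by rewrite card_vspacef.
    rewrite -subn1; case/dvdnP: dN => j ->.
    by rewrite (mulnC j) dvdn_expS_mul_pred.
  by exists c.
have [r0 [d0 [r0N Qr0]]] := trace_form_normal_form hp hodd a alpha.
have [s s0 Qc] := trace_form_similarity hp a alphaE cP.
rewrite -hf in Qr0 Qc.
have [e Qre tE] := qrank_normal_form r0N Qr0.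
have rN : (qrank (trace_form f) <= n)%N by rewrite -hL -ltnS ltn_ord.
have lE : trace_nullity f = (n - qrank (trace_form f))%N by rewrite /trace_nullity /nullity hL.
have [||dl te] := similarity_nullity_type hp hodd _ Qre D0 _ cP s0 Qc; rewrite ?hL //.
have rE : (n - trace_nullity f = qrank (trace_form f))%N by rewrite lE subKn.
rewrite rE DE /trace_type tE lE -hL dl.
set r := qrank _ in rN te *.
have main : (if r == 0%N then 1 else quad_char e) = (-1) ^+ (((p - 1) ^ 2 %/ 4 * D + 1) * (r %/ (2 * D))).
  have [rz|/te->] := posnP r; first by rewrite rz div0n muln0.
  (* The exponent carries [((p-1)/2)^2] where the similarity argument gave [(p-1)/2]; the two have
     the same parity. *)
  have -> : ((p - 1) ^ 2 %/ 4 = (p - 1)./2 ^ 2)%N.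
    have {1}-> : (p - 1 = (p - 1)./2 * 2)%N.
      by rewrite muln2 even_halfK // oddB ?prime_gt0 // hodd.
    by rewrite expnMn mulnK.
  by rewrite -signr_odd -[RHS]signr_odd !oddM !oddD !oddM andbb.
split=> //; rewrite main.
case: eqP => [nu0|/eqP]; first by rewrite /D nu0 muln1.
rewrite -lt0n => nu0.
(* For [nu > 0] the number [D] is even, so the first factor of the exponent is odd. *)
by rewrite -signr_odd oddM oddD oddM /D oddX gtn_eqF // andbF /= signr_odd.
Qed.
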